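(* Let $\mathcal{O}$ be a Dedekind domain and let $\mathcal{L}\supseteq \mathcal{K}$ be fixed nonzero ideals of $\mathcal{O}$, with $\mathcal{I}$ the ideal given by the factorization $\mathcal{K}=\mathcal{L}\mathcal{I}$. Then there is a bijection between the set of co-torsion submodules (of rank two) $M\subseteq\mathcal{O}^2$ having invariant factor ideals $\mathcal{L}\supseteq \mathcal{K}$ and the projective space $\mathbb{PF}^1_{\mathcal{I}}$.
   Context: An $\mathcal{O}$-submodule $M\subseteq \mathcal{O}^2$ is co-torsion if $\mathcal{O}^2/M$ is a torsion $\mathcal{O}$-module; such a module automatically has rank two (a maximal $\mathcal{O}$-linearly independent subset has two elements). Invariant factor ideals: for a co-torsion $M\subseteq\mathcal{O}^2$ there are finitely many distinct maximal ideals $\mathcal{M}_1,\dots,\mathcal{M}_r$ of $\mathcal{O}$ and integers $0\le l_i\le k_i\ne 0$ with $\mathcal{O}^2/M\cong\bigoplus_{i=1}^r\big(\mathcal{O}/\mathcal{M}_i^{l_i}\oplus\mathcal{O}/\mathcal{M}_i^{k_i}\big)$ ($r=0$ if $M=\mathcal{O}^2$). The invariant factor ideals of $M$ are $\mathcal{L}=\prod_{i}\mathcal{M}_i^{l_i}\supseteq\mathcal{K}=\prod_{i}\mathcal{M}_i^{k_i}$, so $\mathcal{O}^2/M\cong\mathcal{O}/\mathcal{L}\oplus\mathcal{O}/\mathcal{K}$ (both are $\mathcal{O}$ if $M=\mathcal{O}^2$). Projective space: let $(\mathcal{O}^2)^{*}=\{(a,b)\in \mathcal{O}^2\mid \langle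 a\rangle +\langle b\rangle = \mathcal{O}\}$. For an ideal $\mathcal{I}\subseteq\mathcal{O}$, define the equivalence relation on $(\mathcal{O}^2)^*$ by $(a,b)\sim (c,d)$ iff $ad-bc\in \mathcal{I}$. Then $\mathbb{PF}^1_{\mathcal{I}}=(\mathcal{O}^2)^{*}/\sim$. *)

(* Defs.v *)
From HB Require Import structures.
From mathcomp Require Import all_boot all_algebra.
From mathcomp Require Import ring.
From mathcomp Require Import boolp.

Set Implicit Arguments.
Unset Strict Implicit.
Unset Printing Implicit Defensive.

Import GRing.Theory.

Local Open Scope ring_scope.
Local Open Scope quotient_scope.

(* Submodules of V are the library's [submodClosed V]: boolean predicates     *)
(* bundled with their closure properties.  By the next lemma, Leibniz         *)
(* equality of submodules is equality of the underlying sets.                 *)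
Lemma submod_ext (R : nzRingType) (V : lmodType R) (S T : submodClosed V) :
  S =i T -> S = T.
Proof.
case: S T => S [[a] [b]] [T [[a'] [b']]] /= eqST.
have {}eqST : S = T by apply: funext => x; exact: eqST.
by subst T; rewrite (Prop_irrelevance a a') (Prop_irrelevance b b').
Qed.

Section QuotientModule.
Variables (R : nzRingType) (V : lmodType R) (S : submodClosed V).

Definition submod_pred : {pred V} := S.
Fact submod_pred_zmod_closed : zmod_closed submod_pred.
Proof. exact: GRing.submod_closedB (submodClosedP S). Qed.
HB.instance Definition _ :=
  GRing.isZmodClosed.Build V submod_pred submod_pred_zmod_closed.

Definition quotmod : Type := Quotient.quot submod_pred.
HB.instance Definition _ := GRing.Zmodule.on quotmod.

Definition quotmod_scale (a : R) (x : quotmod) : quotmod :=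
  \pi_(Quotient.quot submod_pred) (a *: repr (x : Quotient.quot submod_pred)).

Lemma quotmod_scale_pi a v :
  quotmod_scale a (\pi_(Quotient.quot submod_pred) v) = \pi_(Quotient.quot submod_pred) (a *: v).
Proof.
apply/eqP; rewrite /quotmod_scale -[_ == _]Quotient.idealrBE -scalerBr.
apply: (@rpredZ _ _ S); change (repr (\pi_(Quotient.quot submod_pred) v) - v \in submod_pred).
by rewrite Quotient.idealrBE reprK.
Qed.

Fact quotmod_scaleA a b x :
  quotmod_scale a (quotmod_scale b x) = quotmod_scale (a * b) x.
Proof.
by elim/(@quotW _ (Quotient.quot submod_pred)): x => v; rewrite !quotmod_scale_pi scalerA.
Qed.

Fact quotmod_scale1 : left_id 1 quotmod_scale.
Proof.
by elim/(@quotW _ (Quotient.quot submod_pred)) => v; rewrite quotmod_scale_pi scale1r.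
Qed.

Fact quotmod_scaleDr : right_distributive quotmod_scale +%R.
Proof.
move=> a; elim/(@quotW _ (Quotient.quot submod_pred)) => v.
elim/(@quotW _ (Quotient.quot submod_pred)) => w.
by rewrite -[_ + _]raddfD !quotmod_scale_pi scalerDr raddfD.
Qed.

Fact quotmod_scaleDl x : {morph quotmod_scale^~ x : a b / a + b}.
Proof.
elim/(@quotW _ (Quotient.quot submod_pred)): x => v a b.
by rewrite !quotmod_scale_pi scalerDl raddfD.
Qed.

HB.instance Definition _ := GRing.Zmodule_isLmodule.Build R quotmod
  quotmod_scaleA quotmod_scale1 quotmod_scaleDr quotmod_scaleDl.

End QuotientModule.

(* The finite direct sum of a family of modules, as dependent finite functions *)
(* with pointwise operations.                                                  *)
Section DirectSum.
Variables (R : nzRingType) (I : finType) (V : I -> lmodType R).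

Definition dirsum : Type := {dffun forall i, V i}.
HB.instance Definition _ := Choice.on dirsum.

Implicit Types f g h : dirsum.

Definition dirsum0 : dirsum := [ffun i => 0 : V i].
Definition dirsum_opp f : dirsum := [ffun i => - f i : V i].
Definition dirsum_add f g : dirsum := [ffun i => f i + g i : V i].
Definition dirsum_scale (a : R) f : dirsum := [ffun i => a *: f i : V i].

Fact dirsum_addA : associative dirsum_add.
Proof. by move=> f g h; apply/ffunP=> i; rewrite !ffunE addrA. Qed.
Fact dirsum_addC : commutative dirsum_add.
Proof. by move=> f g; apply/ffunP=> i; rewrite !ffunE addrC. Qed.
Fact dirsum_add0 : left_id dirsum0 dirsum_add.
Proof. by move=> f; apply/ffunP=> i; rewrite !ffunE add0r. Qed.
Fact dirsum_addN : left_inverse dirsum0 dirsum_opp dirsum_add.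
Proof. by move=> f; apply/ffunP=> i; rewrite !ffunE addNr. Qed.

HB.instance Definition _ := GRing.isZmodule.Build dirsum
  dirsum_addA dirsum_addC dirsum_add0 dirsum_addN.

Fact dirsum_scaleA a b f :
  dirsum_scale a (dirsum_scale b f) = dirsum_scale (a * b) f.
Proof. by apply/ffunP=> i; rewrite !ffunE scalerA. Qed.
Fact dirsum_scale1 : left_id 1 dirsum_scale.
Proof. by move=> f; apply/ffunP=> i; rewrite !ffunE scale1r. Qed.
Fact dirsum_scaleDr : right_distributive dirsum_scale +%R.
Proof. by move=> a f g; apply/ffunP=> i; rewrite !ffunE scalerDr. Qed.
Fact dirsum_scaleDl f : {morph dirsum_scale^~ f : a b / a + b}.
Proof. by move=> a b; apply/ffunP=> i; rewrite !ffunE scalerDl. Qed.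

HB.instance Definition _ := GRing.Zmodule_isLmodule.Build R dirsum
  dirsum_scaleA dirsum_scale1 dirsum_scaleDr dirsum_scaleDl.

End DirectSum.

Definition lmod_iso (R : nzRingType) (V W : lmodType R) : Prop :=
  exists f : {linear V -> W}, bijective f.

Definition torsion_module (R : nzRingType) (V : lmodType R) : Prop :=
  forall v : V, exists2 a : R, a != 0 & a *: v = 0.

(* MathComp's [idealr] only covers proper ideals, so ideals are taken to be    *)
(* submodules of the regular module.                                           *)
Notation ideal R := (submodClosed R^o).

Section Ideals.
Variable R : comNzRingType.
Implicit Types I J : ideal R.

Definition unit_ideal_pred : {pred R^o} := fun _ => true.
Fact unit_ideal_closed : submod_closed unit_ideal_pred.
Proof. by []. Qed.
HB.instance Definition _ :=
  GRing.isSubmodClosed.Build R R^o unit_ideal_pred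
    (GRing.submod_closed_semi unit_ideal_closed).
Definition unit_ideal : ideal R := unit_ideal_pred.

Definition principal_pred (a : R) : {pred R^o} :=
  fun x => `[< exists c : R, x = c * a >].
Fact principal_closed a : submod_closed (principal_pred a).
Proof.
split=> [|c x y /asboolP[d ->] /asboolP[e ->]]; apply/asboolP.
  by exists 0; rewrite mul0r.
by exists (c * d + e); rewrite mulrDl -mulrA.
Qed.
HB.instance Definition _ a :=
  GRing.isSubmodClosed.Build R R^o (principal_pred a)
    (GRing.submod_closed_semi (principal_closed a)).
Definition principal a : ideal R := principal_pred a.

Definition ideal_add_pred I J : {pred R^o} :=
  fun x => `[< exists2 u : R, u \in I & exists2 v : R, v \in J & x = u + v >].
Fact ideal_add_closed I J : submod_closed (ideal_add_pred I J).
Proof.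
split=> [|c x y /asboolP[u Iu [v Jv ->]] /asboolP[u' Iu' [v' Jv' ->]]];
  apply/asboolP.
  by exists 0; [exact: rpred0|exists 0; [exact: rpred0|rewrite addr0]].
have lin (S : ideal R) z z' : z \in S -> z' \in S -> c *: (z : R^o) + z' \in S.
  by have [_ linS] := submodClosedP S; exact: linS.
exists (c *: (u : R^o) + u'); first exact: lin.
exists (c *: (v : R^o) + v'); first exact: lin.
by rewrite [LHS]/(_ *: _ + _) scalerDr addrACA.
Qed.
HB.instance Definition _ I J :=
  GRing.isSubmodClosed.Build R R^o (ideal_add_pred I J)
    (GRing.submod_closed_semi (ideal_add_closed I J)).
Definition ideal_add I J : ideal R := ideal_add_pred I J.

Definition ideal_mul_pred I J : {pred R^o} :=
  fun x => `[< exists n (u v : 'I_n -> R),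
    (forall i, u i \in I /\ v i \in J) /\ x = \sum_(i < n) u i * v i >].
Fact ideal_mul_closed I J : submod_closed (ideal_mul_pred I J).
Proof.
split=> [|c x y /asboolP[n [u [v [uvP ->]]]] /asboolP[m [u' [v' [uvP' ->]]]]];
  apply/asboolP.
  by exists 0, (fun=> 0), (fun=> 0); split=> [[]//|]; rewrite big_ord0.
pose w1 i := match split i with inl j => c * u j | inr j => u' j end.
pose w2 i := match split i with inl j => v j | inr j => v' j end.
exists (n + m)%N, w1, w2; split=> [i|].
  rewrite /w1 /w2; case: (split i) => j; last exact: uvP'.
  by have [Iu Jv] := uvP j; split=> //; exact: (@rpredZ _ _ I c (u j) Iu).
rewrite big_split_ord /= scaler_sumr; congr (_ + _); apply: eq_bigr => i _.
  by rewrite /w1 /w2 (unsplitK (inl i : 'I_n + 'I_m)) -mulrA.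
by rewrite /w1 /w2 (unsplitK (inr i : 'I_n + 'I_m)).
Qed.
HB.instance Definition _ I J :=
  GRing.isSubmodClosed.Build R R^o (ideal_mul_pred I J)
    (GRing.submod_closed_semi (ideal_mul_closed I J)).
Definition ideal_mul I J : ideal R := ideal_mul_pred I J.

Definition ideal_exp I n : ideal R := iter n (ideal_mul I) unit_ideal.

Definition nonzero_ideal I : Prop := exists2 x : R, x \in I & x != 0.

Definition ideal_proper I : Prop := 1 \notin I.

Definition prime_ideal I : Prop :=
  ideal_proper I /\ forall x y : R, x * y \in I -> x \in I \/ y \in I.

Definition maximal_ideal I : Prop :=
  ideal_proper I /\ forall J, {subset I <= J} -> ideal_proper J -> J = I.

Definition finitely_generated I : Prop :=
  exists n (g : 'I_n -> R), forall x : R,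
    x \in I <-> exists c : 'I_n -> R, x = \sum_(i < n) c i * g i.

Definition noetherian : Prop := forall I, finitely_generated I.

End Ideals.

Definition integrally_closed (R : idomainType) : Prop :=
  forall z : {fraction R}, integralOver (@tofrac R) z ->
    exists a : R, z = tofrac a.

(* Krull dimension at most one: fields are allowed.                            *)
Definition dedekind_domain (R : idomainType) : Prop :=
  [/\ noetherian R,
      integrally_closed R
    & forall P : ideal R, nonzero_ideal P -> prime_ideal P -> maximal_ideal P].

Section InvariantFactors.
Variable R : idomainType.

(* Rank two is not required separately: it follows from the quotient being     *)
(* torsion.                                                                    *)
Definition cotorsion (M : submodClosed (R^o * R^o)%type) : Prop :=
  torsion_module (quotmod M).

(* If M is the whole module then r = 0, and L and K are the unit ideal.        *)
Definition invariant_factors (M : submodClosed (R^o * R^o)%type) (L K : ideal R) : Prop :=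
  exists (r : nat) (m : 'I_r -> ideal R) (l k : 'I_r -> nat),
    [/\ injective m /\ (forall i, maximal_ideal (m i)),
        forall i, (l i <= k i)%N /\ k i <> 0%N,
        lmod_iso (quotmod M)
          (dirsum (fun i => (quotmod (ideal_exp (m i) (l i)) *
                             quotmod (ideal_exp (m i) (k i)))%type : lmodType R)),
        L = \big[@ideal_mul R/unit_ideal R]_(i < r) ideal_exp (m i) (l i)
      & K = \big[@ideal_mul R/unit_ideal R]_(i < r) ideal_exp (m i) (k i)].

End InvariantFactors.

Section ProjectiveLine.
Variables (R : comNzRingType) (I : ideal R).

Definition unimodular (p : R * R) : Prop :=
  ideal_add (principal p.1) (principal p.2) = unit_ideal R.

Definition unimodular_pair : Type := {p : R * R | `[< unimodular p >]}.
HB.instance Definition _ := Choice.on unimodular_pair.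

Definition proj_equiv (p q : unimodular_pair) : bool :=
  (\val p).1 * (\val q).2 - (\val p).2 * (\val q).1 \in I.

Lemma unimodular_bezout (p : R * R) :
  unimodular p -> exists x y, x * p.1 + y * p.2 = 1.
Proof.
move=> up; have : 1 \in ideal_add (principal p.1) (principal p.2).
  by rewrite up.
by case/asboolP=> _ /asboolP[x ->] [_ /asboolP[y ->] ->]; exists x, y.
Qed.

Fact proj_equiv_equiv : equiv_class_of proj_equiv.
Proof.
have idl (a x : R) : x \in I -> a * x \in I by exact: (@rpredZ _ _ I a x).
have idD (x y : R) : x \in I -> y \in I -> x + y \in I by exact: (@rpredD _ I).
have sym p q : proj_equiv p q -> proj_equiv q p.
  rewrite /proj_equiv => pq; move: (idl (-1) _ pq).
  by rewrite mulN1r opprB mulrC [X in _ - X]mulrC.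
split=> [p|p q|q p s].
- by rewrite /proj_equiv mulrC subrr; exact: (@rpred0 _ I).
- by apply/idP/idP; exact: sym.
case: q => [[c d] cd]; have [x [y /= xy1]] := unimodular_bezout (asboolW cd).
case: p s => [[a b] ?] [[e f] ?]; rewrite /proj_equiv /= => pq qs.
have -> : a * f - b * e = x * (a * (c * f - d * e) + e * (a * d - b * c))
                        + y * (f * (a * d - b * c) + b * (c * f - d * e)).
  by rewrite -[LHS]mul1r -xy1; ring.
by rewrite idD ?idl ?idD ?idl.
Qed.

Canonical proj_equiv_equivRel := EquivRelPack proj_equiv_equiv.
Canonical proj_equiv_encModRel := defaultEncModRel proj_equiv.

Definition proj_line : Type := {eq_quot proj_equiv}.

End ProjectiveLine.

(* Main.v *)
Require Import Defs.
From HB Require Import structures.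
From mathcomp Require Import all_boot all_algebra.
From mathcomp Require Import ring.
From mathcomp Require Import boolp.

Set Implicit Arguments.
Unset Strict Implicit.
Unset Printing Implicit Defensive.

Import GRing.Theory.

Local Open Scope ring_scope.
Local Open Scope quotient_scope.

(* The point (a : b) corresponds to the module L(a, b) + K O^2, that is, to
   { v in L^2 | v_1 b - v_2 a in K }.  A Bezout relation for (a, b) gives a
   matrix of determinant -1 carrying this module onto L x K, and the Chinese
   remainder theorem yields its invariant factors.  Two points give the same
   module iff L (ad - bc) is contained in K = L I, that is, iff ad - bc is in I,
   because L is invertible.  Conversely, an isomorphism of O^2 / M with
   O/L + O/K lifts to a matrix that is invertible modulo L and takes M to the
   part of its image lying in L x K; its second coordinate is a linear form
   whose coefficients are unimodular modulo K, and a pair unimodular modulo K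
   lifts to a unimodular pair because O/(q) has stable rank one for q != 0.

   Invertibility of ideals is the classical argument: in a maximal P choose
   b != 0 and a not in (b) with aP contained in (b); as O is integrally closed,
   aP is not contained in bP, hence P(a, b) = (b).  The general case follows by
   Noetherian induction. *)

(** * Ideal arithmetic *)

Section IdealArithmetic.
Variable R : comNzRingType.
Implicit Types (A B C : ideal R) (x y z : R).

Lemma ideal0 A : (0 : R) \in A.
Proof. exact: (@rpred0 _ A). Qed.

Lemma idealD A x y : x \in A -> y \in A -> x + y \in A.
Proof. exact: (@rpredD _ A). Qed.

Lemma idealMl A x y : y \in A -> x * y \in A.
Proof. exact: (@rpredZ _ _ A x y). Qed.

Lemma idealMr A x y : x \in A -> x * y \in A.
Proof. by rewrite mulrC; apply: idealMl. Qed.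

Lemma idealN A x : x \in A -> - x \in A.
Proof. by rewrite -mulN1r; apply: idealMl. Qed.

Lemma idealB A x y : x \in A -> y \in A -> x - y \in A.
Proof. by move=> Ax Ay; apply/idealD/idealN. Qed.

Lemma ideal_sum A (J : Type) (r : seq J) (P : pred J) (F : J -> R) :
  (forall i, P i -> F i \in A) -> \sum_(i <- r | P i) F i \in A.
Proof. exact: (@rpred_sum _ A). Qed.

Lemma ideal_congr A x y : x - y \in A -> (x \in A) = (y \in A).
Proof.
move=> Axy; apply/idP/idP => [Ax|Ay]; last by rewrite -[x](subrK y) idealD.
by rewrite -[y](subKr x) idealB.
Qed.

Lemma ideal_eqP A B : {subset A <= B} -> {subset B <= A} -> A = B.
Proof. by move=> sAB sBA; apply: submod_ext => x; apply/idP/idP; auto. Qed.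

Lemma ideal_mulE A B x y : x \in A -> y \in B -> x * y \in ideal_mul A B.
Proof.
move=> Ax By; apply/asboolP; exists 1%N, (fun=> x), (fun=> y).
by rewrite big_ord1.
Qed.

Lemma ideal_mul_sub A B C :
  (forall x y, x \in A -> y \in B -> x * y \in C) -> {subset ideal_mul A B <= C}.
Proof.
move=> ABC _ /asboolP[n [u [v [uv ->]]]]; apply: ideal_sum => i _.
by have [] := uv i; apply: ABC.
Qed.

Lemma ideal_mulC : commutative (@ideal_mul R).
Proof.
by move=> A B; apply: ideal_eqP; apply: ideal_mul_sub => x y ? ?;
  rewrite mulrC; apply: ideal_mulE.
Qed.

Lemma ideal_mulSS A B A' B' : {subset A <= A'} -> {subset B <= B'} ->
  {subset ideal_mul A B <= ideal_mul A' B'}.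
Proof. by move=> sA sB; apply: ideal_mul_sub => x y /sA ? /sB; apply: ideal_mulE. Qed.

Lemma ideal_mulA : associative (@ideal_mul R).
Proof.
have sub A B C : {subset ideal_mul A (ideal_mul B C) <= ideal_mul (ideal_mul A B) C}.
  apply: ideal_mul_sub => x _ Ax /asboolP[n [u [v [uv ->]]]].
  rewrite mulr_sumr; apply: ideal_sum => i _; rewrite mulrA.
  by have [Bu Cv] := uv i; rewrite !ideal_mulE.
move=> A B C; apply: ideal_eqP; first exact: sub.
rewrite (ideal_mulC A (ideal_mul B C)) (ideal_mulC _ C) (ideal_mulC A B) (ideal_mulC B C).
exact: sub.
Qed.

Lemma ideal_mul1 : left_id (unit_ideal R) (@ideal_mul R).
Proof.
move=> A; apply: ideal_eqP; first by apply: ideal_mul_sub => x y _; apply: idealMl.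
by move=> x Ax; rewrite -[x]mul1r ideal_mulE.
Qed.

HB.instance Definition _ := Monoid.isComLaw.Build (ideal R) (unit_ideal R)
  (@ideal_mul R) ideal_mulA ideal_mulC ideal_mul1.

Lemma ideal_mul_subl A B : {subset ideal_mul A B <= A}.
Proof. by apply: ideal_mul_sub => x y Ax _; apply: idealMr. Qed.

Lemma ideal_mul_subr A B : {subset ideal_mul A B <= B}.
Proof. by rewrite ideal_mulC; apply: ideal_mul_subl. Qed.

Lemma ideal_expD A m n :
  ideal_exp A (m + n) = ideal_mul (ideal_exp A m) (ideal_exp A n).
Proof.
by elim: m => [|m IH]; rewrite ?ideal_mul1 // addSn /ideal_exp !iterS -!/(ideal_exp _ _)
  IH ideal_mulA.
Qed.

Lemma unit_idealP A : 1 \in A -> A = unit_ideal R.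
Proof.
by move=> A1; apply: ideal_eqP => // x _; rewrite -[x]mulr1; apply: idealMl.
Qed.

Lemma principalP (a x : R) : reflect (exists c, x = c * a) (x \in principal a).
Proof. exact: asboolP. Qed.

Lemma mem_principal (a : R) : a \in principal a.
Proof. by apply/principalP; exists 1; rewrite mul1r. Qed.

Lemma principal_sub (a : R) A : a \in A -> {subset principal a <= A}.
Proof. by move=> Aa _ /principalP[c ->]; apply: idealMl. Qed.

Lemma ideal_mul_principal a A x :
  reflect (exists2 y, y \in A & x = a * y) (x \in ideal_mul (principal a) A).
Proof.
apply: (iffP idP) => [/asboolP[n [u [v [uv ->]]]]|[y Ay ->]]; last first.
  by rewrite ideal_mulE ?mem_principal.
have /choice[w wP] i : exists c, u i = c * a by apply/principalP; case: (uv i).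
exists (\sum_i w i * v i).
  by apply: ideal_sum => i _; apply: idealMl; case: (uv i).
by rewrite mulr_sumr; apply: eq_bigr => i _; rewrite wP mulrA (mulrC a).
Qed.

Lemma ideal_addP A B x :
  reflect (exists2 u, u \in A & exists2 v, v \in B & x = u + v) (x \in ideal_add A B).
Proof. exact: asboolP. Qed.

Lemma mem_ideal_addl A B x : x \in A -> x \in ideal_add A B.
Proof. by move=> Ax; apply/ideal_addP; exists x => //; exists 0; rewrite ?addr0 ?ideal0. Qed.

Lemma mem_ideal_addr A B x : x \in B -> x \in ideal_add A B.
Proof. by move=> Bx; apply/ideal_addP; exists 0; rewrite ?ideal0 //; exists x; rewrite ?add0r. Qed.

(** The ideal quotient (A : x), that is, the annihilator of the class of [x] in R/A. *)
Definition colon_pred A x : {pred R^o} := fun y : R => y * x \in A.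
Fact colon_closed A x : submod_closed (colon_pred A x).
Proof.
split=> [|c y z]; rewrite !unfold_in /=; first by rewrite mul0r; apply: ideal0.
by move=> Ay Az; rewrite mulrDl -mulrA; apply: idealD => //; apply: idealMl.
Qed.
HB.instance Definition _ A x :=
  GRing.isSubmodClosed.Build R R^o (colon_pred A x)
    (GRing.submod_closed_semi (colon_closed A x)).
Definition colon A x : ideal R := colon_pred A x.

Lemma colonE A x y : (y \in colon A x) = (y * x \in A).
Proof. by []. Qed.

Lemma maximal_ideal_prime A : maximal_ideal A -> prime_ideal A.
Proof.
case=> pA maxA; split=> // x y Axy; case: (boolP (x \in A)) => Ax; [by left|right].
apply: contrapT => nAy; pose B := ideal_add A (principal x).
have sAB : {subset A <= B} by move=> z; apply: mem_ideal_addl.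
have /negP nB1 : ~~ (1 \notin B).
  apply: contra Ax => /(maxA _ sAB) <-.
  exact/mem_ideal_addr/mem_principal.
have {nB1} /ideal_addP[u Au [_ /principalP[c ->] e1]] : 1 \in B by apply/negPn/negP.
apply: nAy; rewrite -[y]mul1r e1 mulrDl -mulrA.
by apply: idealD; [exact: idealMr|exact: idealMl].
Qed.

(** A + B = R, stated through a witness: [e] is 0 modulo A and 1 modulo B, which is what the Chinese
    remainder theorem consumes. *)
Definition comaximal A B := exists2 e, e \in A & 1 - e \in B.

Lemma comaximal_sym A B : comaximal A B -> comaximal B A.
Proof. by case=> e Ae Be; exists (1 - e); rewrite ?subKr. Qed.

Lemma comaximalM A B C : comaximal A B -> comaximal A C -> comaximal A (ideal_mul B C).
Proof.
case=> e Ae Be [f Af Cf]; exists (e + f - e * f).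
  by rewrite idealB ?idealD ?idealMl.
have -> : 1 - (e + f - e * f) = (1 - e) * (1 - f) by ring.
exact: ideal_mulE.
Qed.

Lemma comaximal1 A : comaximal A (unit_ideal R).
Proof. by exists 0; rewrite ?ideal0. Qed.

Lemma comaximal_exp A B m n : comaximal A B -> comaximal (ideal_exp A m) (ideal_exp B n).
Proof.
move=> AB; have {AB} AB : comaximal A (ideal_exp B n).
  by elim: n => [|n IH]; [exact: comaximal1|exact: comaximalM].
apply: comaximal_sym; elim: m => [|m IH]; first exact: comaximal1.
by apply: comaximalM => //; apply: comaximal_sym.
Qed.

Lemma comaximal_big A (J : eqType) (F : J -> ideal R) (r : seq J) :
  (forall i, i \in r -> comaximal A (F i)) ->
  comaximal A (\big[@ideal_mul R/unit_ideal R]_(i <- r) F i).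
Proof.
elim: r => [|j r IH] AF; rewrite ?big_nil ?big_cons; first exact: comaximal1.
apply: comaximalM; first by apply: AF; rewrite mem_head.
by apply: IH => i ri; apply: AF; rewrite inE ri orbT.
Qed.

Lemma maximal_comaximal A B : maximal_ideal A -> maximal_ideal B -> A <> B -> comaximal A B.
Proof.
move=> [pA mA] [pB mB] nAB; apply: contrapT => nc; apply: nAB.
have pAB : ideal_proper (ideal_add A B).
  apply/negP => /ideal_addP[u Au [v Bv e1]]; apply: nc; exists u => //.
  by rewrite e1 addrC addKr.
rewrite -(mA _ _ pAB); last by move=> x; apply: mem_ideal_addl.
by apply: mB pAB => x; apply: mem_ideal_addr.
Qed.

(** For comaximal ideals the product is the intersection: with [e] in the first factor and 1 - e in
    the product of the others, x = (1 - e)x + ex. *)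
Lemma mem_big_comaximal (J : eqType) (F : J -> ideal R) (r : seq J) x :
  uniq r -> (forall i j, i != j -> comaximal (F i) (F j)) ->
  (x \in \big[@ideal_mul R/unit_ideal R]_(i <- r) F i) = all (fun i => x \in F i) r.
Proof.
move=> + Fc; elim: r => [|j r IH]; first by rewrite big_nil.
rewrite big_cons /= => /andP[jr /IH <-]; apply/idP/andP => [Fx|[Fx Gx]].
  by split; [move: Fx; apply: ideal_mul_subl|move: Fx; apply: ideal_mul_subr].
have /comaximal_big[e Fe Ge] i : i \in r -> comaximal (F j) (F i).
  by move=> ri; apply: Fc; apply: contraNneq jr => ->.
rewrite -[x]mul1r -[1](subrK e) mulrDl idealD //; last exact: ideal_mulE.
by rewrite mulrC ideal_mulE.
Qed.

Lemma chinese_remainder (J : finType) (F : J -> ideal R) (y : J -> R) :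
  (forall i j, i != j -> comaximal (F i) (F j)) ->
  exists x, forall i, x - y i \in F i.
Proof.
move=> Fc.
(* Each [e i] is 1 modulo [F i] and 0 modulo every other ideal of the family. *)
have /choice[e eP] i : exists e : R, e - 1 \in F i /\ forall j, j != i -> e \in F j.
  have [|e Fe Ge] := @comaximal_big (F i) _ F [seq j <- index_enum J | j != i].
    by move=> j; rewrite mem_filter eq_sym => /andP[/Fc].
  exists (1 - e); split=> [|j ji].
    by rewrite addrAC subrr sub0r idealN.
  move: Ge; rewrite mem_big_comaximal ?filter_uniq ?index_enum_uniq //.
  by move=> /allP/(_ j); rewrite mem_filter ji mem_index_enum; apply.
exists (\sum_i e i * y i) => i; rewrite (bigD1 i) //= addrAC.
apply: idealD; last first.
  by apply: ideal_sum => j ji; rewrite idealMr //; apply: (eP j).2; rewrite eq_sym.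
by rewrite -[X in _ - X]mul1r -mulrBl idealMr //; apply: (eP i).1.
Qed.

End IdealArithmetic.

(** * Noetherian rings *)

Section Noetherian.
Variable R : comNzRingType.
Implicit Types A B : ideal R.

Lemma generator_mem A n (g : 'I_n -> R) (i : 'I_n) :
  (forall x : R, x \in A <-> exists c : 'I_n -> R, x = \sum_(i < n) c i * g i) ->
  g i \in A.
Proof.
move=> gP; apply/gP; exists (fun j => (j == i)%:R).
rewrite (bigD1 i) //= eqxx mul1r big1 ?addr0 // => j /negPf->.
by rewrite mul0r.
Qed.

(** The monotonicity proof is an argument because closure under addition, hence the instance below,
    depends on it. *)
Definition chain_union_pred (u : nat -> ideal R)
  (u_homo : forall m n, (m <= n)%N -> {subset u m <= u n}) : {pred R^o} :=
  fun x => `[< exists n, x \in u n >].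
Fact chain_union_closed u u_homo : submod_closed (@chain_union_pred u u_homo).
Proof.
split=> [|c x y /asboolP[m mx] /asboolP[n ny]]; apply/asboolP.
  by exists 0%N; apply: ideal0.
exists (maxn m n); apply: idealD; last by apply: u_homo ny; apply: leq_maxr.
by apply: idealMl; apply: u_homo mx; apply: leq_maxl.
Qed.
HB.instance Definition _ u u_homo :=
  GRing.isSubmodClosed.Build R R^o (@chain_union_pred u u_homo)
    (GRing.submod_closed_semi (chain_union_closed u_homo)).

(** Otherwise choice produces a strictly increasing chain in [S]; the union of the chain is finitely
    generated, so the chain stops. *)
Lemma noetherian_max (S : ideal R -> Prop) A0 : noetherian R -> S A0 ->
  exists2 A, S A & forall B, S B -> {subset A <= B} -> B = A.
Proof.
move=> nR SA0; apply: contrapT => nmax.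
have /choice[next nextP] (A : {A | S A}) :
    exists B : {A | S A}, {subset sval A <= sval B} /\ sval B <> sval A.
  case: A => A SA; apply: contrapT => nB; apply: nmax; exists A => // B SB sAB.
  by apply: contrapT => nBA; apply: nB; exists (exist _ B SB).
pose u n := sval (iter n next (exist _ A0 SA0)).
have u_homo m n : (m <= n)%N -> {subset u m <= u n}.
  move=> /subnKC <-; elim: (n - m)%N => [|k IH x /IH]; first by rewrite addn0.
  by rewrite addnS; apply: (nextP _).1.
pose U : ideal R := chain_union_pred u_homo.
have [n [g gP]] := nR U.
have /choice[e eP] i : exists k, g i \in u k by apply/asboolP/(generator_mem i gP).
(* All generators of the union already lie in [u N], so the next term of the chain cannot be
   larger. *)
pose N := (\max_i e i)%N.
apply: (nextP (iter N next (exist _ A0 SA0))).2; apply: ideal_eqP; last exact: (nextP _).1.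
move=> x Nx; have /gP[c ->] : x \in U by apply/asboolP; exists N.+1.
apply: ideal_sum => i _; apply: idealMl; apply: (u_homo _ _ _ _ (eP i)).
by rewrite /N (bigD1 i) //= leq_maxl.
Qed.

Lemma noetherian_maximal A : noetherian R -> ideal_proper A ->
  exists2 P, maximal_ideal P & {subset A <= P}.
Proof.
move=> nR pA.
have [P [pP sAP] maxP] := @noetherian_max
  (fun B => ideal_proper B /\ {subset A <= B}) A nR (conj pA (fun x => id)).
exists P => //; split=> // B sPB pB; apply: maxP => //; split=> // x /sAP; exact: sPB.
Qed.

(** An associated prime of R/A: a maximal element among the (A : x) with x outside A is prime, since
    (A : zx) contains (A : x) and must equal it when zx is not in A. *)
Lemma maximal_colon_prime A : noetherian R -> ideal_proper A ->
  exists2 x, x \notin A & prime_ideal (colon A x).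
Proof.
move=> nR pA.
have [|_ [x Ax ->] maxP] := @noetherian_max
  (fun B => exists2 x, x \notin A & B = colon A x) (colon A 1) nR.
  by exists 1.
exists x => //; split=> [|y z]; first by rewrite /ideal_proper colonE mul1r.
rewrite !colonE => Ayzx; case: (boolP (z * x \in A)) => Azx; [by right|left].
suff e : colon A (z * x) = colon A x by rewrite -colonE -e colonE mulrA.
apply: maxP; first by exists (z * x).
by move=> w; rewrite !colonE mulrCA; apply: idealMl.
Qed.

End Noetherian.

(* A finitely generated faithful module stable under [a / b] makes it integral. *)
Lemma integrally_closed_dvd (R : idomainType) (A : ideal R) (a b : R) :
  integrally_closed R -> finitely_generated A -> nonzero_ideal A -> b != 0 ->
  {subset ideal_mul (principal a) A <= ideal_mul (principal b) A} ->
  a \in principal b.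
Proof.
move=> icR [n [g gP]] [x Ax x0] b0 sab.
have /choice[C CP] i : exists c : 'I_n -> R, a * g i = b * \sum_j c j * g j.
  have /sab/ideal_mul_principal[y /gP[c ->] ->] : a * g i \in ideal_mul (principal a) A.
    by rewrite ideal_mulE ?mem_principal ?(generator_mem i gP).
  by exists c.
(* The coefficients are transposed because [eigenvalue] uses row vectors: the row of generators is
   an eigenvector of [N] for a/b, so a/b is a root of a monic polynomial over R. *)
pose N := (\matrix_(i, j) C j i) : 'M_n.
have bF : tofrac b != 0 by rewrite tofrac_eq0.
have [|c] := icR (tofrac a / tofrac b).
  exists (char_poly N); first exact: char_poly_monic.
  rewrite map_char_poly -eigenvalue_root_char; apply/eigenvalueP.
  exists (\row_i tofrac (g i)).
    apply/rowP => i; rewrite !mxE; apply: (mulfI bF).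
    rewrite mulrA mulrCA divff // mulr1 -tofracM CP tofracM; congr (_ * _).
    by rewrite rmorph_sum; apply: eq_bigr => j _; rewrite !mxE /= -tofracM mulrC.
  apply: contraNneq x0 => g0; have /gP[c ->] := Ax; rewrite big1 // => i _.
  by move/rowP/(_ i): g0; rewrite !mxE => /eqP; rewrite tofrac_eq0 => /eqP->; rewrite mulr0.
move=> /(congr1 ( *%R^~ (tofrac b))); rewrite divfK // -tofracM => /eqP.
rewrite tofrac_eq => /eqP->.
by apply/principalP; exists c.
Qed.

(** * Dedekind domains *)

Section Dedekind.
Variable R : idomainType.
Implicit Types (A B C P : ideal R) (a b c : R).

Lemma principalM a b : ideal_mul (principal a) (principal b) = principal (a * b).
Proof.
apply: ideal_eqP => [x /ideal_mul_principal[_ /principalP[c ->] ->]|x /principalP[c ->]].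
  by apply/principalP; exists c; rewrite mulrCA.
by apply: idealMl; rewrite ideal_mulE ?mem_principal.
Qed.

Lemma principal_mulS c A B : c != 0 ->
  {subset ideal_mul (principal c) A <= ideal_mul (principal c) B} -> {subset A <= B}.
Proof.
move=> c0 sAB x Ax; have /sAB : c * x \in ideal_mul (principal c) A.
  by rewrite ideal_mulE ?mem_principal.
by case/ideal_mul_principal => y By /(mulfI c0) ->.
Qed.

Lemma nonzero_idealS A B : {subset A <= B} -> nonzero_ideal A -> nonzero_ideal B.
Proof. by move=> sAB [x /sAB]; exists x. Qed.

(** Avoids fractional ideals: the inverse of A would be A'/c. *)
Definition invertible_ideal A :=
  exists (A' : ideal R) c, c != 0 /\ ideal_mul A A' = principal c.

Lemma invertible_mulS A B C : invertible_ideal A ->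
  {subset ideal_mul A B <= ideal_mul A C} -> {subset B <= C}.
Proof.
move=> [A' [c [c0 AA']]] sBC; apply: (principal_mulS c0).
by rewrite -AA' !(ideal_mulC A) -!ideal_mulA; apply: ideal_mulSS.
Qed.

(** The quotient is A P'/c; it is an ideal of R because A P' lies in P P' = (c), and it is encoded
    as the colon ideal (A P' : c). *)
Lemma invertible_divides P A : invertible_ideal P -> {subset A <= P} ->
  exists B, A = ideal_mul P B.
Proof.
move=> [P' [c [c0 PP']]] sAP; pose B := colon (ideal_mul A P') c; exists B.
have cB : ideal_mul (principal c) B = ideal_mul A P'.
  apply: ideal_eqP => x; first by case/ideal_mul_principal=> y; rewrite colonE mulrC => ? ->.
  move=> AP'x; have /principalP[y e] : x \in principal c.
    by rewrite -PP'; apply: ideal_mulSS AP'x.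
  by apply/ideal_mul_principal; exists y; rewrite ?colonE -?e // mulrC.
have e : ideal_mul (principal c) A = ideal_mul (principal c) (ideal_mul P B).
  by rewrite (ideal_mulC P) ideal_mulA cB -PP' -ideal_mulA (ideal_mulC P') ideal_mulC.
by apply: ideal_eqP; apply: (principal_mulS c0); rewrite e.
Qed.

Hypothesis hR : dedekind_domain R.

Let nR : noetherian R. Proof. by case: hR. Qed.
Let icR : integrally_closed R. Proof. by case: hR. Qed.

Lemma maximal_invertible P : maximal_ideal P -> nonzero_ideal P -> invertible_ideal P.
Proof.
move=> mP [b Pb b0]; have [pP primeP] := maximal_ideal_prime mP.
(* [J] replaces the localization of (b) at P: by maximality, no element outside P is a zero divisor
   modulo [J]. *)
have [J [t Pt defJ] maxJ] := @noetherian_max R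
  (fun J => exists2 t, t \notin P & J = colon (principal b) t) (colon (principal b) 1)
  nR (ex_intro2 _ _ (1 : R) pP erefl).
have pJ : ideal_proper J.
  rewrite /ideal_proper defJ colonE mul1r.
  by apply: contra Pt; apply: principal_sub.
have [x Jx primeQ] := maximal_colon_prime nR pJ.
(* The prime (J : x) contains b, hence is maximal; it lies in P because an element outside P cannot
   kill x modulo J. *)
have QP : colon J x = P.
  have mQ : maximal_ideal (colon J x).
    case: hR => _ _; apply=> //; exists b => //.
    rewrite colonE defJ colonE -mulrA mulrC.
    by apply: idealMl; apply: mem_principal.
  apply/esym; case: mQ => _; apply=> // y; rewrite colonE => Jyx.
  apply: contraNT Jx => Py.
  suff e : colon (principal b) (y * t) = J.
    by rewrite -e colonE mulrA (mulrC x) -colonE -defJ.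
  apply: maxJ.
    exists (y * t) => //; apply/negP => /primeP[] Pz; first by rewrite Pz in Py.
    by rewrite Pz in Pt.
  by move=> z; rewrite defJ !colonE mulrCA; apply: idealMl.
pose a := x * t.
have nba : a \notin principal b by move: Jx; rewrite defJ colonE.
have Pa y : y \in P -> y * a \in principal b.
  by rewrite -QP colonE defJ colonE mulrA.
pose D := ideal_add (principal a) (principal b).
have Da : a \in D by apply/mem_ideal_addl/mem_principal.
have Db : b \in D by apply/mem_ideal_addr/mem_principal.
exists D, b; split=> //; apply: ideal_eqP.
  apply: ideal_mul_sub => y _ Py /ideal_addP[_ /principalP[u ->] [_ /principalP[v ->] ->]].
  rewrite mulrDr (mulrCA y u) (mulrCA y v).
  by apply: idealD; apply: idealMl; [apply: Pa|apply: idealMl; apply: mem_principal].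
apply: principal_sub; apply: contraNT nba => PDb.
(* If b is not in P D, then E is proper and contains P, so E = P. Writing ya = cb for y in P puts c
   in E = P; thus aP lies in bP, and integral closedness forces a into (b). *)
pose E := colon (ideal_mul P D) b.
have EP : E = P.
  case: mP => _; apply; first by move=> y Py; rewrite colonE ideal_mulE.
  by rewrite /ideal_proper colonE mul1r.
apply: (@integrally_closed_dvd R P) => //; first by exists b.
move=> _ /ideal_mul_principal[y Py ->]; have /principalP[c e] := Pa y Py.
rewrite mulrC e mulrC ideal_mulE ?mem_principal // -EP colonE -e.
by rewrite ideal_mulE.
Qed.

(** Take A maximal among the nonzero non-invertible ideals and write A = P B with P maximal. An
    invertible B would make A invertible, so B = A by maximality, and A = P A has to be refuted. *)
Lemma ideal_invertible A : nonzero_ideal A -> invertible_ideal A.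
Proof.
move=> nzA; apply: contrapT => niA.
have {A nzA niA} [A [nzA niA] maxA] := @noetherian_max R
  (fun A => nonzero_ideal A /\ ~ invertible_ideal A) A nR (conj nzA niA).
have pA : ideal_proper A.
  apply/negP => /unit_idealP defA; apply: niA.
  exists (unit_ideal R), 1; rewrite oner_neq0 defA ideal_mul1; split=> //.
  by apply/esym/unit_idealP/mem_principal.
have [P mP sAP] := noetherian_maximal nR pA.
have iP := maximal_invertible mP (nonzero_idealS sAP nzA).
have [B defA] := invertible_divides iP sAP.
have sAB : {subset A <= B} by rewrite {1}defA; apply: ideal_mul_subr.
have [P' [c [c0 PP']]] := iP.
case: (pselect (invertible_ideal B)) => [[B' [d [d0 BB']]]|niB].
  apply: niA; exists (ideal_mul P' B'), (c * d); rewrite mulf_neq0 //; split=> //.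
  by rewrite -principalM -PP' -BB' defA -!ideal_mulA; congr ideal_mul;
    rewrite !ideal_mulA (ideal_mulC B).
have {B niB sAB} defA : A = ideal_mul P A.
  by rewrite {1}defA (maxA B) //; split=> //; apply: nonzero_idealS nzA.
case/negP: mP.1; rewrite -/(is_true _).
(* For a in P', aA lies in P' A = P' P A = cA, so a is in (c) by integrality. Hence c is in P P',
   contained in P(c), and cancelling c gives 1 in P. *)
have : c \in ideal_mul P (principal c).
  have : c \in ideal_mul P P' by rewrite PP' mem_principal.
  apply: ideal_mulSS => // a P'a; apply: (@integrally_closed_dvd R A) => //.
  rewrite -PP' [X in ideal_mul _ X]defA => x.
  rewrite (ideal_mulC P P') -ideal_mulA -defA.
  by apply: ideal_mulSS => //; apply: principal_sub.
by rewrite ideal_mulC => /ideal_mul_principal[y Py]; rewrite -[LHS]mulr1 => /(mulfI c0) ->.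
Qed.

Lemma ideal_mulS_cancel A B C : nonzero_ideal A ->
  {subset ideal_mul A B <= ideal_mul A C} -> {subset B <= C}.
Proof. by move=> /ideal_invertible; apply: invertible_mulS. Qed.

(** * Factorization into maximal ideals *)

Definition ideal_prod r (m : 'I_r -> ideal R) (e : 'I_r -> nat) : ideal R :=
  \big[@ideal_mul R/unit_ideal R]_(i < r) ideal_exp (m i) (e i).

(* An arbitrary product [ideal_prod m e] is carried along, so that two ideals
   can be factored over a common family. *)
Lemma ideal_factorization A r (m : 'I_r -> ideal R) (e : 'I_r -> nat) :
  nonzero_ideal A -> injective m -> (forall i, maximal_ideal (m i)) ->
  exists r' (m' : 'I_r' -> ideal R) (e' f : 'I_r' -> nat),
    [/\ injective m', forall i, maximal_ideal (m' i),
        ideal_prod m' e' = ideal_prod m e & A = ideal_prod m' f].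
Proof.
move=> nzA m_inj m_max; apply: contrapT => nfA.
have {A nzA nfA} [A [nzA nfA] maxA] := @noetherian_max R
  (fun A => nonzero_ideal A /\ ~ _) A nR (conj nzA nfA).
apply: nfA.
case: (boolP (1 \in A)) => [/unit_idealP ->|pA].
  exists r, m, e, (fun=> 0%N); split=> //.
  by rewrite /ideal_prod big1.
have [P mP sAP] := noetherian_maximal nR pA.
have [B defA] := invertible_divides (ideal_invertible (nonzero_idealS sAP nzA)) sAP.
have sAB : {subset A <= B} by rewrite {1}defA; apply: ideal_mul_subr.
have [|nfB] := pselect (exists r' (m' : 'I_r' -> ideal R) (e' f : 'I_r' -> nat),
    [/\ injective m', forall i, maximal_ideal (m' i),
        ideal_prod m' e' = ideal_prod m e & B = ideal_prod m' f]); last first.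
  (* Here B = A by maximality, so A = P A, and cancelling A would give P = R. *)
  case/negP: mP.1; rewrite -/(is_true _).
  have sP : {subset unit_ideal R <= P}.
    apply: (ideal_mulS_cancel nzA); rewrite ideal_mulC ideal_mul1 {1}defA (maxA B) //.
      by rewrite ideal_mulC.
    by split=> //; apply: nonzero_idealS nzA.
  exact: sP.
case=> r' [m' [e' [f [m'_inj m'_max defe defB]]]].
have [[j mj]|nPm] := pselect (exists j, m' j = P).
  exists r', m', e', (fun i => (i == j) + f i)%N; split=> //.
  rewrite defA defB /ideal_prod -mj (bigD1 j) //= [RHS](bigD1 j) //= eqxx.
  rewrite add1n /ideal_exp iterS -ideal_mulA; congr (ideal_mul _ (ideal_mul _ _)).
  by apply: eq_bigr => i /negPf->.
(* A new prime P is put at index 0, with exponent 0 in the carried product and 1 in the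
   factorization of A. *)
pose ext (T : Type) (x : T) (g : 'I_r' -> T) (i : 'I_r'.+1) := oapp g x (unlift ord0 i).
have ext0 T x g : @ext T x g ord0 = x by rewrite /ext unlift_none.
have extS T x g i : @ext T x g (lift ord0 i) = g i by rewrite /ext liftK.
have prod_ext (a : nat) g : ideal_prod (ext _ P m') (ext _ a g) =
    ideal_mul (ideal_exp P a) (ideal_prod m' g).
  rewrite /ideal_prod big_ord_recl !ext0; congr ideal_mul.
  by apply: eq_bigr => i _; rewrite !extS.
exists r'.+1, (ext _ P m'), (ext _ 0%N e'), (ext _ 1%N f); split.
- move=> i j; case: (unliftP ord0 i) => [i'|] ->; case: (unliftP ord0 j) => [j'|] ->;
    rewrite ?ext0 ?extS // => eP; first by rewrite (m'_inj _ _ eP).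
    by case: nPm; exists i'.
  by case: nPm; exists j'.
- by move=> i; case: (unliftP ord0 i) => [i'|] ->; rewrite ?ext0 ?extS.
- by rewrite prod_ext ideal_mul1.
- by rewrite prod_ext defA defB [ideal_exp P 1]ideal_mulC ideal_mul1.
Qed.

Lemma common_factorization A B : nonzero_ideal A -> nonzero_ideal B ->
  exists r (m : 'I_r -> ideal R) (l e : 'I_r -> nat),
    [/\ injective m /\ (forall i, maximal_ideal (m i)),
        forall i, (l i + e i)%N <> 0%N,
        A = ideal_prod m l & B = ideal_prod m e].
Proof.
move=> nzA nzB.
have [||r1 [m1 [_ [l1 [m1_inj m1_max _ defA]]]]] :=
  @ideal_factorization A 0 (fun=> A) (fun=> 0%N) nzA; try by case.
have [r [m [l [e [m_inj m_max defl defB]]]]] := ideal_factorization l1 nzB m1_inj m1_max.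
(* Primes dividing neither ideal are dropped, since invariant factors demand a nonzero larger
   exponent. *)
pose S := [pred i | (l i + e i)%N != 0%N].
have restrict g : (forall i, i \notin S -> g i = 0%N) ->
    ideal_prod (m \o @enum_val _ S) (g \o @enum_val _ S) = ideal_prod m g.
  move=> g0; rewrite /ideal_prod [RHS](bigID [in S]) /= [X in ideal_mul _ X]big1 => [|i /g0 -> //].
  rewrite ideal_mulC ideal_mul1.
  by rewrite [RHS]big_enum_val.
exists #|S|, (m \o @enum_val _ S), (l \o @enum_val _ S), (e \o @enum_val _ S); split.
- by split=> [i j /= /m_inj /enum_val_inj|i] //=.
- by move=> i; apply/eqP; have := enum_valP i.
- rewrite restrict ?defl // => i; rewrite inE negbK addn_eq0 => /andP[/eqP //].
- rewrite restrict // => i; rewrite inE negbK addn_eq0 => /andP[_ /eqP //].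
Qed.

End Dedekind.

(** * Lifting pairs that are unimodular modulo an ideal *)

Section UnimodularLift.
Variable R : idomainType.
Implicit Types (A D K : ideal R) (q s x y k : R).
Hypothesis hR : dedekind_domain R.

Let nR : noetherian R. Proof. by case: hR. Qed.

(* Stabilizing (q) : s^n yields the largest divisor A of (q) coprime to s; [t] is 0 modulo A
   and 1 modulo s. *)
Lemma coprime_shift q s k x y : q != 0 -> x * q + y * s + k = 1 ->
  exists t u v, u * q + v * (s + t * k) = 1.
Proof.
move=> q0 bez.
have [A [n defA] maxA] := @noetherian_max R
  (fun A => exists n, A = colon (principal q) (s ^+ n)) _ nR (ex_intro _ 0%N erefl).
have Aq : q \in A by rewrite defA colonE mulrC idealMl ?mem_principal.
have AsA z : z * s \in A -> z \in A.
  rewrite -colonE => Az; rewrite -(maxA (colon A s)) //.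
    by exists n.+1; apply: submod_ext => w; rewrite colonE defA !colonE -mulrA -exprS.
  by move=> w; rewrite colonE; apply: idealMr.
have nzA : nonzero_ideal A by exists q.
have sAN : {subset A <= ideal_add A (principal s)} by move=> z; apply: mem_ideal_addl.
(* To see that A + (s) = R, write A = (A + (s))B. Then sB lies in A, so B lies in A = (A + (s))B,
   and B can be cancelled. *)
have [B defB] := invertible_divides (ideal_invertible hR (nonzero_idealS sAN nzA)) sAN.
have sBA : {subset B <= A}.
  move=> b Bb; apply: AsA; rewrite defB mulrC ideal_mulE //.
  exact/mem_ideal_addr/mem_principal.
have nzB : nonzero_ideal B.
  by apply: nonzero_idealS nzA => z; rewrite {1}defB; apply: ideal_mul_subr.
have : {subset unit_ideal R <= ideal_add A (principal s)}.
  apply: (ideal_mulS_cancel hR nzB); rewrite ideal_mulC ideal_mul1 ideal_mulC -defB.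
  exact: sBA.
move=> /(_ 1 isT) /ideal_addP[t At [_ /principalP[c ->] e1]].
exists t; pose D := ideal_add (principal q) (principal (s + t * k)).
have Dq : q \in D by apply/mem_ideal_addl/mem_principal.
have Dst : s + t * k \in D by apply/mem_ideal_addr/mem_principal.
suff /ideal_addP[_ /principalP[u ->] [_ /principalP[v ->] ->]] : 1 \in D by exists u, v.
apply: contrapT => /negP pD; have [P mP sDP] := noetherian_maximal nR pD.
have [/negP pP primeP] := maximal_ideal_prime mP; apply: pP.
(* Since t is in A, t s^n is in (q), which lies in P; subtracting its multiple by k from s^n (s +
   tk) puts s^(n+1) in P. Then tk is in P, and either factor in P contradicts a Bezout relation. *)
have Ps : s \in P.
  have : s ^+ n.+1 \in P.
    rewrite exprS -[X in X * _](addrK (t * k)) mulrBl.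
    apply: idealB; first exact/idealMr/sDP.
    rewrite mulrAC; apply/idealMr/(principal_sub (sDP _ Dq)).
    by rewrite -colonE -defA.
  elim: (n.+1) => [|j IH]; first by rewrite expr0 => P1; rewrite -[s]mulr1 idealMl.
  by rewrite exprS => /primeP[].
have /primeP[Pt|Pk] : t * k \in P.
  by rewrite -[t * k](addKr s); apply: idealD; [exact: idealN|exact: sDP].
  by rewrite e1; apply: idealD => //; apply: idealMl.
rewrite -bez; apply: idealD => //; apply: idealD; apply: idealMl => //.
exact: sDP.
Qed.

Lemma unimodular_lift K q s x y : nonzero_ideal K -> 1 - (x * q + y * s) \in K ->
  exists p : R * R, [/\ unimodular p, p.1 - q \in K & p.2 - s \in K].
Proof.
move=> [k0 Kk0 k00] Kbez.
(* [coprime_shift] needs a nonzero first entry; if q = 0, a nonzero element of K serves instead.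
   Only the second entry is then shifted. *)
suff [q' [q'0 Kq']] : exists q', q' != 0 /\ q' - q \in K.
  pose k := 1 - (x * q' + y * s).
  have Kk : k \in K.
    have -> : k = 1 - (x * q + y * s) - x * (q' - q) by rewrite /k; ring.
    by rewrite idealB ?idealMl.
  have [|t [u [v e]]] := @coprime_shift q' s k x y q'0; first by rewrite /k addrC subrK.
  exists (q', s + t * k); split=> //=; last by rewrite addrC addKr idealMl.
  apply/unit_idealP/ideal_addP.
  exists (u * q'); first by apply/principalP; exists u.
  by exists (v * (s + t * k)) => //; apply/principalP; exists v.
have [->|q0] := eqVneq q 0; first by exists k0; rewrite subr0.
by exists q; rewrite subrr ideal0.
Qed.

End UnimodularLift.

(** * Linear projections and the first isomorphism theorem *)

Section QuotientMaps.
Variables (R : nzRingType) (V : lmodType R) (M : submodClosed V).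

(** A separate name for the projection, to carry its linear structure. *)
Definition quot_proj (v : V) : quotmod M := \pi_(Quotient.quot (submod_pred M)) v.

Fact quot_proj_is_linear : linear quot_proj.
Proof.
move=> a u v; rewrite /quot_proj raddfD; congr (_ + _).
exact/esym/quotmod_scale_pi.
Qed.
HB.instance Definition _ := GRing.isLinear.Build R V (quotmod M) *:%R quot_proj
  quot_proj_is_linear.

Lemma quot_proj_surj x : exists v, quot_proj v = x.
Proof. by exists (repr (x : Quotient.quot (submod_pred M))); rewrite /quot_proj reprK. Qed.

Lemma quot_proj_eq u v : quot_proj u = quot_proj v <-> u - v \in M.
Proof.
rewrite -[_ \in M]/(u - v \in submod_pred M) Quotient.idealrBE.
by split=> [/eqP|/eqP].
Qed.

Lemma quot_proj_eq0 v : quot_proj v = 0 <-> v \in M.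
Proof. by rewrite -[0](linear0 quot_proj) quot_proj_eq subr0. Qed.

Lemma lmod_iso_quot (W : lmodType R) (phi : {linear V -> W}) :
  (forall v, phi v = 0 <-> v \in M) -> (forall w, exists v, phi v = w) ->
  lmod_iso (quotmod M) W.
Proof.
move=> kerphi surjphi.
have [lift liftK] := choice quot_proj_surj; have [sec secK] := choice surjphi.
have phiE u v : quot_proj u = quot_proj v <-> phi u = phi v.
  rewrite quot_proj_eq -kerphi linearB.
  by split=> /eqP; [rewrite subr_eq0 => /eqP|rewrite -subr_eq0 => /eqP].
pose f x := phi (lift x).
have f_lin : linear f.
  move=> a x y; rewrite /f -linearP; apply/phiE.
  by rewrite quot_proj_is_linear !liftK.
pose F : {linear quotmod M -> W} := HB.pack f (GRing.isLinear.Build R _ W *:%R f f_lin).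
exists F; exists (fun w => quot_proj (sec w)) => [x|w] /=.
  by rewrite -[RHS]liftK; apply/phiE; rewrite secK.
by rewrite -[RHS]secK; apply/phiE; rewrite liftK.
Qed.

End QuotientMaps.

(** * The Chinese remainder map on pairs *)

Section ResidueMap.
Variables (R : comNzRingType) (J : finType) (A B : J -> ideal R).

Definition residue_sum : lmodType R :=
  dirsum (fun i => (quotmod (A i) * quotmod (B i))%type : lmodType R).

Definition residue_map (v : (R^o * R^o)%type) : residue_sum :=
  [ffun i => (quot_proj (A i) v.1, quot_proj (B i) v.2) : (quotmod (A i) * quotmod (B i))%type].

Fact residue_map_is_linear : linear residue_map.
Proof.
move=> a u v; apply/ffunP => i; rewrite !ffunE /=.
by congr pair; rewrite quot_proj_is_linear.
Qed.
HB.instance Definition _ := GRing.isLinear.Build R (R^o * R^o)%type residue_sum *:%R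
  residue_map residue_map_is_linear.

Hypothesis coA : forall i j, i != j -> comaximal (A i) (A j).
Hypothesis coB : forall i j, i != j -> comaximal (B i) (B j).

Lemma residue_map_eq0 v : residue_map v = 0 <->
  v.1 \in \big[@ideal_mul R/unit_ideal R]_i A i /\
  v.2 \in \big[@ideal_mul R/unit_ideal R]_i B i.
Proof.
have memA := mem_big_comaximal (v.1 : R) (index_enum_uniq J) coA.
have memB := mem_big_comaximal (v.2 : R) (index_enum_uniq J) coB.
split=> [/ffunP v0|[]].
  by split; [apply: etrans memA _|apply: etrans memB _]; apply/allP => i _;
    have := v0 i; rewrite !ffunE => -[/quot_proj_eq0 ? /quot_proj_eq0 ?].
move=> /(etrans (esym memA))/allP Av /(etrans (esym memB))/allP Bv.
apply/ffunP => i; rewrite !ffunE.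
by congr pair; apply/quot_proj_eq0; [apply: Av|apply: Bv]; rewrite mem_index_enum.
Qed.

Lemma residue_map_surj w : exists v, residue_map v = w.
Proof.
have /choice[a aP] i : exists a, quot_proj (A i) a = (w i).1 by apply: quot_proj_surj.
have /choice[b bP] i : exists b, quot_proj (B i) b = (w i).2 by apply: quot_proj_surj.
have [x xP] := chinese_remainder a coA; have [y yP] := chinese_remainder b coB.
exists (x, y); apply/ffunP => i; rewrite ffunE [RHS]surjective_pairing -aP -bP.
by congr pair; apply/quot_proj_eq; [apply: xP|apply: yP].
Qed.

End ResidueMap.

(** * The lattice attached to a point of the projective line *)

Section LineLattice.
Variable R : comNzRingType.
Implicit Types (L K I : ideal R) (p : R * R).

(* L * (p.1, p.2) + K * R^2, for unimodular [p] and [K] contained in [L]. *)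
Definition line_lattice_pred L K p : {pred (R^o * R^o)%type} :=
  fun v => [&& v.1 \in L, v.2 \in L & v.1 * p.2 - v.2 * p.1 \in K].
Fact line_lattice_closed L K p : submod_closed (line_lattice_pred L K p).
Proof.
split=> [|a u v /and3P[L1 L2 Kp] /and3P[L1' L2' Kp']]; apply/and3P.
  by split; rewrite ?mul0r ?subrr; apply: ideal0.
split; [by apply: idealD => //; apply: idealMl..|].
have -> : (a *: u + v).1 * p.2 - (a *: u + v).2 * p.1 =
    a * (u.1 * p.2 - u.2 * p.1) + (v.1 * p.2 - v.2 * p.1) :> R.
  by rewrite /= /GRing.scale /=; ring.
by apply: idealD => //; apply: idealMl.
Qed.
HB.instance Definition _ L K p :=
  GRing.isSubmodClosed.Build R (R^o * R^o)%type (line_lattice_pred L K p)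
    (GRing.submod_closed_semi (line_lattice_closed L K p)).
Definition line_lattice L K p : submodClosed (R^o * R^o)%type := line_lattice_pred L K p.

Lemma line_latticeP L K p v :
  reflect [/\ v.1 \in L, v.2 \in L & v.1 * p.2 - v.2 * p.1 \in K] (v \in line_lattice L K p).
Proof. exact: and3P. Qed.

(** The matrix with rows (a, b) and (c, d) acting on column vectors. *)
Definition frame_map (a b c d : R) (v : (R^o * R^o)%type) : (R^o * R^o)%type :=
  (v.1 * a + v.2 * b, v.1 * c + v.2 * d).

Fact frame_map_is_linear a b c d : linear (frame_map a b c d).
Proof.
move=> e u v; rewrite /frame_map /=.
by congr pair; rewrite /= /GRing.scale /=; ring.
Qed.
HB.instance Definition _ a b c d :=
  GRing.isLinear.Build R (R^o * R^o)%type (R^o * R^o)%type *:%R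
    (frame_map a b c d) (frame_map_is_linear a b c d).

End LineLattice.

(** * The correspondence *)

Section Classification.
Variable R : idomainType.
Implicit Types (L K I : ideal R) (p q : R * R) (M : submodClosed (R^o * R^o)%type).

Lemma comaximal_maximal_exp r (m : 'I_r -> ideal R) (e : 'I_r -> nat) i j :
  injective m -> (forall i, maximal_ideal (m i)) -> i != j ->
  comaximal (ideal_exp (m i) (e i)) (ideal_exp (m j) (e j)).
Proof.
move=> m_inj m_max ij; apply/comaximal_exp/maximal_comaximal => // /m_inj eij.
by rewrite eij eqxx in ij.
Qed.

(** Every element of K kills the quotient. *)
Lemma line_lattice_cotorsion L K p :
  {subset K <= L} -> nonzero_ideal K -> cotorsion (line_lattice L K p).
Proof.
move=> sKL [k Kk k0] x; have [v <-] := quot_proj_surj x; exists k => //.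
have <- := linearZ_LR (quot_proj (line_lattice L K p)) k v.
apply/quot_proj_eq0/line_latticeP; split; try by apply/sKL/idealMr.
have -> : (k *: v).1 * p.2 - (k *: v).2 * p.1 = k * (v.1 * p.2 - v.2 * p.1) :> R.
  by rewrite /= /GRing.scale /=; ring.
exact: idealMr.
Qed.

Lemma line_lattice_invariants (hR : dedekind_domain R) L K I p :
  nonzero_ideal L -> nonzero_ideal I -> K = ideal_mul L I -> unimodular p ->
  invariant_factors (line_lattice L K p) L K.
Proof.
move=> nzL nzI defK /unimodular_bezout[x [y bez]].
have sKL : {subset K <= L} by rewrite defK; apply: ideal_mul_subl.
have [r [m [l [e [[m_inj m_max] le_nz defL defI]]]]] := common_factorization hR nzL nzI.
pose k i := (l i + e i)%N.
have {}defK : K = ideal_prod m k.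
  rewrite defK defL defI /ideal_prod -big_split; apply: eq_bigr => i _.
  exact/esym/ideal_expD.
have coL i j : i != j -> comaximal (ideal_exp (m i) (l i)) (ideal_exp (m j) (l j)).
  exact: comaximal_maximal_exp.
have coK i j : i != j -> comaximal (ideal_exp (m i) (k i)) (ideal_exp (m j) (k j)).
  exact: comaximal_maximal_exp.
exists r, m, l, k; split=> //.
  by move=> i; split; [apply: leq_addr|apply: le_nz].
pose h := residue_map (fun i => ideal_exp (m i) (l i)) (fun i => ideal_exp (m i) (k i)).
(* The determinant is -(x p.1 + y p.2) = -1, and the lattice is the preimage of L x K under [u]. *)
pose u := frame_map x y p.2 (- p.1).
apply: (@lmod_iso_quot _ _ _ _ (h \o u)) => [v|w] /=.
  rewrite /h residue_map_eq0 // -/(ideal_prod m l) -/(ideal_prod m k) -defL -defK /u /=.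
  split=> [[Lv Kv]|/line_latticeP[Lv1 Lv2 Kv]]; last first.
    by split; [apply: idealD; apply: idealMr|rewrite mulrN].
  apply/line_latticeP; rewrite -mulrN; split=> //.
    have -> : v.1 = p.1 * (v.1 * x + v.2 * y) + y * (v.1 * p.2 + v.2 * - p.1) :> R.
      by rewrite -[LHS]mulr1 -bez; ring.
    by apply: idealD; apply: idealMl => //; apply: sKL.
  have -> : v.2 = p.2 * (v.1 * x + v.2 * y) - x * (v.1 * p.2 + v.2 * - p.1) :> R.
    by rewrite -[LHS]mulr1 -bez; ring.
  by apply: idealB; apply: idealMl => //; apply: sKL.
have [[a b] <-] := residue_map_surj coL coK w.
(* The inverse matrix of [u] applied to (a, b). *)
exists (a * p.1 + b * y, a * p.2 - b * x); rewrite /h; congr residue_map.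
rewrite /u /frame_map /=; congr pair.
  by rewrite -[RHS]mulr1 -bez; ring.
by rewrite -[RHS]mulr1 -bez; ring.
Qed.

Lemma line_lattice_eq (hR : dedekind_domain R) L K I p q :
  nonzero_ideal L -> K = ideal_mul L I -> unimodular p -> unimodular q ->
  line_lattice L K p = line_lattice L K q <-> p.1 * q.2 - p.2 * q.1 \in I.
Proof.
move=> nzL defK up uq; split=> [epq|].
  have : {subset principal (p.1 * q.2 - p.2 * q.1) <= I}.
    apply: (ideal_mulS_cancel hR nzL); apply: ideal_mul_sub => l _ Ll /principalP[c ->].
    rewrite mulrCA; apply: idealMl; rewrite -defK.
    (* Testing the equality on L p shows that L (p.1 q.2 - p.2 q.1) lies in K = L I; then L is
       cancelled. *)
    have : (l * p.1, l * p.2) \in line_lattice L K q.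
      rewrite -epq; apply/line_latticeP; split; try exact: idealMr.
      have -> : l * p.1 * p.2 - l * p.2 * p.1 = 0 by ring.
      exact: ideal0.
    case/line_latticeP => _ _ /=.
    by have -> : l * p.1 * q.2 - l * p.2 * q.1 = l * (p.1 * q.2 - p.2 * q.1) by ring.
  by apply; apply: mem_principal.
have sub p' q' : unimodular p' -> p'.1 * q'.2 - p'.2 * q'.1 \in I ->
    {subset line_lattice L K p' <= line_lattice L K q'}.
  move=> /unimodular_bezout[x [y bez]] Ipq v /line_latticeP[Lv1 Lv2 Kv].
  apply/line_latticeP; split=> //.
  have -> : v.1 * q'.2 - v.2 * q'.1 =
      (x * v.1 + y * v.2) * (p'.1 * q'.2 - p'.2 * q'.1)
      + (x * q'.1 + y * q'.2) * (v.1 * p'.2 - v.2 * p'.1) :> R.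
    by rewrite -[LHS]mulr1 -bez; ring.
  apply: idealD; last exact: idealMl.
  by rewrite defK; apply: ideal_mulE => //; apply: idealD; apply: idealMl.
move=> Ipq; apply: submod_ext => v; apply/idP/idP; apply: sub => //.
have -> : q.1 * p.2 - q.2 * p.1 = - (p.1 * q.2 - p.2 * q.1) by ring.
exact: idealN.
Qed.

Lemma line_lattice_exists (hR : dedekind_domain R) L K M :
  {subset K <= L} -> nonzero_ideal K -> invariant_factors M L K ->
  exists2 p, unimodular p & M = line_lattice L K p.
Proof.
move=> sKL nzK [r [m [l [k [[m_inj m_max] _ [f f_bij] defL defK]]]]].
have coL i j : i != j -> comaximal (ideal_exp (m i) (l i)) (ideal_exp (m j) (l j)).
  exact: comaximal_maximal_exp.
have coK i j : i != j -> comaximal (ideal_exp (m i) (k i)) (ideal_exp (m j) (k j)).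
  exact: comaximal_maximal_exp.
pose h := residue_map (fun i => ideal_exp (m i) (l i)) (fun i => ideal_exp (m i) (k i)).
have h0 v : h v = 0 <-> v.1 \in L /\ v.2 \in K.
  by rewrite /h residue_map_eq0 // defL defK.
have h_surj w : exists v, h v = w by apply: residue_map_surj.
have h_lin (s t : R) x y : h (s *: x + t *: y) = s *: h x + t *: h y.
  by rewrite /h linearD !linearZ_LR.
pose g v := f (quot_proj M v).
have g_lin (s t : R) x y : g (s *: x + t *: y) = s *: g x + t *: g y.
  by rewrite /g !linearD !linearZ_LR.
(* Lifts of the images of the standard basis are the columns of a matrix [u] that lifts the
   isomorphism through [h]. *)
have [[a c] hac] := h_surj (g (1, 0)); have [[b d] hbd] := h_surj (g (0, 1)).
pose u := frame_map a b c d.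
have hu v : h (u v) = g v.
  have -> : u v = v.1 *: (a, c) + v.2 *: (b, d) by [].
  rewrite h_lin hac hbd -g_lin; congr g; case: v => v1 v2.
  by congr pair; rewrite /= /GRing.scale /= ?mulr0 ?mulr1 ?addr0 ?add0r.
have MP v : v \in M <-> v.1 * a + v.2 * b \in L /\ v.1 * c + v.2 * d \in K.
  rewrite -(h0 (u v)) hu /g -quot_proj_eq0; split=> [->|]; first exact: linear0.
  by rewrite -[0](linear0 f) => /(bij_inj f_bij).
have u_surj w : exists v, (u v).1 - w.1 \in L /\ (u v).2 - w.2 \in K.
  have [f' _ fK] := f_bij; have [v gv] := quot_proj_surj (f' (h w)).
  exists v; apply/(h0 (u v - w)).
  have -> : h (u v - w) = h (u v) - h w by apply: linearB.
  by rewrite hu /g gv fK subrr.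
(* [v] and [w] form a right inverse of the matrix modulo L x K. *)
have [[v1 v2] /= [Lv Kv]] := u_surj (1, 0).
have [[w1 w2] /= [Lw Kw]] := u_surj (0, 1).
(* [w] shows that (d, -c) is unimodular modulo K. For p = (d, -c) the form z.1 p.2 - z.2 p.1 is
   minus the second coordinate of [u z]. *)
have [|p [up Kp1 Kp2]] := @unimodular_lift R hR K d (- c) w2 (- w1) nzK.
  rewrite -[_ - _]opprB; apply: idealN.
  by have -> : w2 * d + - w1 * - c - 1 = w1 * c + w2 * d - 1 by ring.
exists p => //.
(* D = (ad - bc)(v1 w2 - v2 w1) is the determinant of the product of the two matrices, so [u] is
   invertible modulo L. *)
pose D := (v1 * a + v2 * b) * (w1 * c + w2 * d) - (w1 * a + w2 * b) * (v1 * c + v2 * d).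
have LD : 1 - D \in L.
  have -> : 1 - D = - (v1 * a + v2 * b - 1) * (w1 * c + w2 * d) - (w1 * c + w2 * d - 1)
     + (w1 * a + w2 * b - 0) * (v1 * c + v2 * d) by rewrite /D; ring.
  apply: idealD; last exact: idealMr.
  by apply: idealB; [apply/idealMr/idealN|apply: sKL].
have Kpv (z : (R^o * R^o)%type) :
    (z.1 * p.2 - z.2 * p.1 \in K) = (z.1 * c + z.2 * d \in K).
  rewrite -[RHS](_ : (- (z.1 * c + z.2 * d) \in K) = _); last first.
    by apply/idP/idP => /idealN; rewrite ?opprK.
  apply: ideal_congr.
  have -> : z.1 * p.2 - z.2 * p.1 - - (z.1 * c + z.2 * d) =
      z.1 * (p.2 - - c) - z.2 * (p.1 - d) :> R by ring.
  by apply: idealB; apply: idealMl.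
apply: submod_ext => z; apply/idP/idP => [/MP[Lz Kz]|/line_latticeP[Lz1 Lz2]].
  have Lz' := sKL _ Kz.
  apply/line_latticeP; rewrite Kpv; split=> //.
    (* Cramer's rule recovers z from [u z] modulo L. *)
    have -> : z.1 = (1 - D) * z.1 + (v1 * w2 - v2 * w1) *
        (d * (z.1 * a + z.2 * b) - b * (z.1 * c + z.2 * d)) :> R by rewrite /D; ring.
    by apply: idealD; [apply: idealMr|apply/idealMl/idealB; apply: idealMl].
  have -> : z.2 = (1 - D) * z.2 + (v1 * w2 - v2 * w1) *
      (a * (z.1 * c + z.2 * d) - c * (z.1 * a + z.2 * b)) :> R by rewrite /D; ring.
  by apply: idealD; [apply: idealMr|apply/idealMl/idealB; apply: idealMl].
by rewrite Kpv => Kz; apply/MP; split=> //; apply: idealD; apply: idealMr.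
Qed.

End Classification.

Theorem theorem5p1 (O : idomainType) (hO : dedekind_domain O)
    (L K I : ideal O) (hL : nonzero_ideal L) (hK : nonzero_ideal K)
    (hKL : {subset K <= L}) (hI : K = ideal_mul L I) :
  exists f : {M : submodClosed (O^o * O^o)%type |
                cotorsion M /\ invariant_factors M L K} -> proj_line I,
    bijective f.
Proof.
have nzI : nonzero_ideal I.
  by apply: nonzero_idealS hK; rewrite hI; apply: ideal_mul_subr.
pose T := {M : submodClosed (O^o * O^o)%type | cotorsion M /\ invariant_factors M L K}.
have unimod (p : unimodular_pair O) : unimodular (val p) by case: p => p up; apply: asboolW.
have lattice_factors (p : unimodular_pair O) :
    cotorsion (line_lattice L K (val p)) /\
    invariant_factors (line_lattice L K (val p)) L K.
  split; first exact: line_lattice_cotorsion.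
  exact: (line_lattice_invariants hO hL nzI hI (unimod p)).
have /choice[point pointP] (M : T) :
    exists p : unimodular_pair O, sval M = line_lattice L K (val p).
  case: M => M /= [_ /(line_lattice_exists hO hKL hK)[p up defM]].
  by exists (exist _ p (asboolT up)).
(* Makes the choice of representatives harmless: both inverse laws reduce to equality of
   lattices. *)
have piE (p q : unimodular_pair O) :
    \pi_(proj_line I) p = \pi_(proj_line I) q <->
    line_lattice L K (val p) = line_lattice L K (val q).
  rewrite (line_lattice_eq hO hL hI) //.
  by split=> [/eqmodP|pq]; last apply/eqmodP.
exists (fun M : T => \pi_(proj_line I) (point M)).
exists (fun x => exist _ (line_lattice L K (val (repr x))) (lattice_factors (repr x))).
  move=> M; apply: eq_sig_hprop => [N|]; first exact: Prop_irrelevance.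
  by rewrite [RHS]pointP; apply/piE; apply: reprK.
move=> x; rewrite -[RHS]reprK; by apply/piE/esym/(pointP (exist _ _ _)).
Qed.
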